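(* Let $a$ and $b$ be nonzero integers that are multiplicatively independent. For almost all primes $p$, at least one of $a$, $b$, $ab$, $a^2 b$, and $ab^2$ has multiplicative order modulo $p$ exceeding $$ p^{8/15}/\exp(2\sqrt{\log p}). $$
   Context: Nonzero rational numbers $a_1,\dots,a_k$ are multiplicatively independent if whenever $a_1^{e_1}\cdots a_k^{e_k}=1$ with integers $e_1,\dots,e_k$, we have $e_1=\dots=e_k=0$. A statement holds for almost all primes $p$ if, as $x\to\infty$, the number of primes $p\le x$ for which it fails is $o(x/\log x)$. The multiplicative order of an integer modulo $p$ is considered only when $p$ does not divide the integer (here this excludes only the finitely many primes dividing $ab$). *)

(* Defs.v *)
From HB Require Import structures.
From mathcomp Require Import all_boot all_order all_algebra all_fingroup.
From mathcomp Require Import all_classical all_reals all_analysis.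

Set Implicit Arguments.
Unset Strict Implicit.
Unset Printing Implicit Defensive.

Import Order.TTheory GRing.Theory Num.Theory.
Import numFieldNormedType.Exports.

Local Open Scope classical_set_scope.
Local Open Scope ring_scope.

Definition mult_independent (k : nat) (a : k.-tuple rat) : Prop :=
  forall e : 'I_k -> int,
    \prod_(i < k) tnth a i ^ e i = 1 -> forall i, e i = 0.

(* For p prime not dividing a. If p divides a, the residue is not a unit and
   [insubd] returns the default value 1, so the result is meaningless. *)
Definition order_mod (p : nat) (a : int) : nat :=
  #[insubd (1%g : {unit 'F_p}) (a%:~R : 'F_p)]%g.

Definition num_exceptions (R : realType) (P : nat -> Prop) (x : R) : nat :=
  (\sum_(0 <= p < (Num.truncn x).+1 | prime p && ~~ `[< P p >]) 1)%N.

Definition almost_all_primes (R : realType) (P : nat -> Prop) : Prop :=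
  (num_exceptions P x)%:R / (x / ln x) @[x --> +oo_R] --> (0 : R).

(* Main.v *)
Require Import Defs.
From HB Require Import structures.
From mathcomp Require Import all_boot all_order all_algebra all_fingroup.
From mathcomp Require Import all_solvable zify ring lra.
From mathcomp Require Import all_classical all_reals all_analysis.
Import Order.TTheory GRing.Theory Num.Theory.
Import numFieldNormedType.Exports.
Local Open Scope classical_set_scope.
Local Open Scope ring_scope.

(** Write [Gamma] for the subgroup of the units of [F_p] generated by [a] and
    [b], and [L] for its order.  Two independent facts give the exponent
    [8/15 = 2/3 * 4/5].

    First, one of the five elements has order at least about [L^(4/5)].  The
    group [Gamma] is cyclic, and the exponent vectors (1,0), (0,1), (1,1), (2,1),
    (1,2) have pairwise determinants [1], [2] or [3] in absolute value.  If [d]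
    and [d'] are the indices in [Gamma] of the subgroups generated by two of the
    elements, then both elements are [gcd d d']-th powers in [Gamma]; inverting
    the 2 x 2 exponent matrix up to its determinant shows that [gcd d d'] divides
    the determinant.  All five indices divide [L] and are almost coprime, so
    their product divides [12 * L] ([prod_gcdn_five]), which gives
    [L^4 <= 12 * (product of the five orders)] ([card_gen2_le_orders]).

    Secondly, [L] is at least about [p^(2/3)] for almost all [p].  If [L < n^2],
    the pigeonhole principle gives a relation [a^u b^v = 1] or [a^u = b^v] in
    [F_p] with [0 <= u, v < n] not both zero ([small_gen2_relation]).  Then [p]
    divides one integer that does not depend on [p], the product of all the
    [a^u b^v - 1] and [a^u - b^v], which is nonzero by multiplicative
    independence.  It has [O(n^2)] factors of [O(n)] bits each, hence at most
    [O(n^3)] prime divisors ([relation_product_le]).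

    Put [S = sqrt (ln x)] and let [F = x^(8/15) / exp(2 S)], which bounds the
    threshold at every prime [p <= x] once [x] is large ([threshold_le]).  If all five orders are at
    most [F], then [L < T^2] with [T^8 = 256 F^5] ([card_lt_of_orders]), so taking
    [n] just above [T] there are [O(T^3) = O(x / exp(15 S / 4))] exceptional
    primes, which is [o(x / ln x)]. *)

Set Implicit Arguments.
Unset Strict Implicit.

(** * Common divisors of integral combinations *)

Lemma dvdn_gcdnMl (a b c r s : nat) :
  (gcdn a c %| r -> gcdn b c %| s -> gcdn (a * b) c %| r * s)%N.
Proof.
move=> har hbs; apply: dvdn_trans (dvdn_mul har hbs).
rewrite muln_gcdr dvdn_gcd; apply/andP; split; last by rewrite dvdn_mull ?dvdn_gcdr.
by rewrite muln_gcdl dvdn_gcd dvdn_gcdl dvdn_mulr // dvdn_gcdr.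
Qed.

Lemma dvdn_mul_gcd (a b m r : nat) :
  (a %| m -> b %| m -> gcdn a b %| r -> a * b %| m * r)%N.
Proof.
by move=> am bm abr; rewrite -muln_lcm_gcd dvdn_mul // dvdn_lcm am.
Qed.

(** Cramer's rule: the determinant times [A], and times [B], is an integral
    combination of the two linear forms.  The disjunction expresses that [m] is
    the absolute value of [i * l - j * k] without subtraction. *)
Lemma dvdn_det (i j k l A B L m : nat) (d : nat) :
    (forall e, e %| L -> e %| A -> e %| B -> e %| 1)%N ->
    (m + j * k = i * l)%N \/ (m + i * l = j * k)%N ->
  (d %| L -> d %| i * A + j * B -> d %| k * A + l * B -> d %| m)%N.
Proof.
move=> cop hdet dL d1 d2.
have gA : (d %| m * A)%N.
  case: hdet => hm.
    have e : (l * (i * A + j * B) = m * A + j * (k * A + l * B))%N by nia.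
    by rewrite -(dvdn_addl _ (dvdn_mull j d2)) -e dvdn_mull.
  have e : (j * (k * A + l * B) = m * A + l * (i * A + j * B))%N by nia.
  by rewrite -(dvdn_addl _ (dvdn_mull l d1)) -e dvdn_mull.
have gB : (d %| m * B)%N.
  case: hdet => hm.
    have e : (i * (k * A + l * B) = m * B + k * (i * A + j * B))%N by nia.
    by rewrite -(dvdn_addl _ (dvdn_mull k d1)) -e dvdn_mull.
  have e : (k * (i * A + j * B) = m * B + i * (k * A + l * B))%N by nia.
  by rewrite -(dvdn_addl _ (dvdn_mull i d2)) -e dvdn_mull.
have /cop : (gcdn L (gcdn A B) %| L)%N by exact: dvdn_gcdl.
rewrite (dvdn_trans (dvdn_gcdr _ _) (dvdn_gcdl _ _)).
rewrite (dvdn_trans (dvdn_gcdr _ _) (dvdn_gcdr _ _)).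
move=> /(_ isT isT); rewrite dvdn1 => /eqP g1.
have : (d %| m * gcdn L (gcdn A B))%N.
  by rewrite !muln_gcdr !dvdn_gcd gA gB dvdn_mull.
by rewrite g1 muln1.
Qed.

(** Each gcd divides [L], and [dvdn_det] bounds the gcd of any two of them by a
    determinant.  The first three are pairwise coprime; adding the fourth costs
    a factor [2], and adding the fifth costs [2 * 3]. *)
Lemma prod_gcdn_five (L A B : nat) :
    (forall e, e %| L -> e %| A -> e %| B -> e %| 1)%N ->
  (gcdn L A * gcdn L B * gcdn L (A + B) * gcdn L (2 * A + B)
     * gcdn L (A + 2 * B) %| L * 12)%N.
Proof.
move=> cop.
have det i j k l m : (m + j * k = i * l)%N \/ (m + i * l = j * k)%N ->
    (gcdn (gcdn L (i * A + j * B)) (gcdn L (k * A + l * B)) %| m)%N.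
  move=> hm; apply: (dvdn_det cop hm).
  - exact: dvdn_trans (dvdn_gcdl _ _) (dvdn_gcdl _ _).
  - exact: dvdn_trans (dvdn_gcdl _ _) (dvdn_gcdr _ _).
  - exact: dvdn_trans (dvdn_gcdr _ _) (dvdn_gcdr _ _).
have -> : gcdn L A = gcdn L (1 * A + 0 * B) by congr gcdn; lia.
have -> : gcdn L B = gcdn L (0 * A + 1 * B) by congr gcdn; lia.
have -> : gcdn L (A + B) = gcdn L (1 * A + 1 * B) by congr gcdn; lia.
have -> : gcdn L (2 * A + B) = gcdn L (2 * A + 1 * B) by congr gcdn; lia.
have -> : gcdn L (A + 2 * B) = gcdn L (1 * A + 2 * B) by congr gcdn; lia.
set d1 := gcdn L (1 * A + 0 * B); set d2 := gcdn L (0 * A + 1 * B).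
set d3 := gcdn L (1 * A + 1 * B); set d4 := gcdn L (2 * A + 1 * B).
set d5 := gcdn L (1 * A + 2 * B).
have d12 : (d1 * d2 %| L * 1)%N.
  by apply: dvdn_mul_gcd; rewrite ?dvdn_gcdl //; apply: det; lia.
have d123 : (d1 * d2 * d3 %| L * 1 * (1 * 1))%N.
  apply: dvdn_mul_gcd; rewrite ?muln1 ?dvdn_gcdl //; first by rewrite muln1 in d12.
  by apply: (@dvdn_gcdnMl _ _ _ 1 1); apply: det; lia.
rewrite !muln1 in d123.
have d1234 : (d1 * d2 * d3 * d4 %| L * (1 * 2 * 1))%N.
  apply: dvdn_mul_gcd; rewrite ?dvdn_gcdl //.
  by apply: dvdn_gcdnMl; [apply: dvdn_gcdnMl|]; apply: det; lia.
have -> : (L * 12 = L * (1 * 2 * 1) * (2 * 1 * 1 * 3))%N by lia.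
apply: dvdn_mul_gcd => //; first exact: dvdn_mulr (dvdn_gcdl _ _).
by apply: dvdn_gcdnMl; [apply: dvdn_gcdnMl; [apply: dvdn_gcdnMl|]|]; apply: det; lia.
Qed.

(** * The subgroup generated by two elements *)

Section TwoGenerators.
Local Open Scope set_scope.
Local Open Scope group_scope.

(** In terms of a generator [g] of the subgroup generated by [x] and [y], the
    order of [g ^+ k] is [#[g] %/ gcdn #[g] k], so this is [prod_gcdn_five] for
    the discrete logarithms of [x] and [y]. *)
Lemma card_gen2_le_orders (gT : finGroupType) (G : {group gT}) (x y : gT) :
    cyclic G -> x \in G -> y \in G ->
  (#|<<[set x; y]>>| ^ 4
     <= 12 * (#[x] * #[y] * #[x * y] * #[x ^+ 2 * y] * #[x * y ^+ 2]))%N.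
Proof.
move=> cycG xG yG.
have sHG : <<[set x; y]>> \subset G.
  by rewrite gen_subG; apply/fintype.subsetP => z; rewrite !inE => /orP[] /eqP->.
have /cyclicP[g Hg] := cyclicS sHG cycG.
have /cycleP[A xA] : x \in <[g]> by rewrite -Hg mem_gen // !inE eqxx.
have /cycleP[B yB] : y \in <[g]> by rewrite -Hg mem_gen // !inE eqxx orbT.
have -> : #|<<[set x; y]>>| = #[g] by rewrite Hg.
(* If e > 1, then x and y would lie in the proper subgroup generated by g ^+ e. *)
have cop e : (e %| #[g] -> e %| A -> e %| B -> e %| 1)%N.
  move=> eg eA eB.
  have sub : <[g]> \subset <[g ^+ e]>.
    rewrite -Hg gen_subG; apply/fintype.subsetP => z; rewrite !inE => /orP[] /eqP->.
      by rewrite xA -(divnK eA) mulnC expgM mem_cycle.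
    by rewrite yB -(divnK eB) mulnC expgM mem_cycle.
  have := subset_leq_card sub; rewrite -!/(order _).
  rewrite (orderXdiv eg); have := dvdn_leq (order_gt0 g) eg.
  have := order_gt0 g; case: e eg {eA eB sub} => [|[|e]] //.
    by rewrite dvd0n => /eqP->.
  by move=> _ g0 _; rewrite leqNgt ltn_Pdiv.
have := dvdn_leq _ (@prod_gcdn_five _ _ _ cop); rewrite muln_gt0 order_gt0 => /(_ isT).
have -> : x ^+ 2 * y = g ^+ (2 * A + B) by rewrite xA yB -expgM -expgD mulnC.
have -> : x * y ^+ 2 = g ^+ (A + 2 * B) by rewrite xA yB -expgM -expgD (mulnC B).
rewrite xA yB -expgD.
have ordE k : (#[g ^+ k] * gcdn #[g] k = #[g])%N by rewrite orderXgcd divnK ?dvdn_gcdl.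
move: (ordE A) (ordE B) (ordE (A + B)%N) (ordE (2 * A + B)%N) (ordE (A + 2 * B)%N).
have := order_gt0 g; move: #[g] => L L0.
move: (gcdn L A) (gcdn L B) (gcdn L (A + B)) (gcdn L (2 * A + B)) (gcdn L (A + 2 * B)).
move: #[_] #[_] #[_] #[_] #[_] => o1 o2 o3 o4 o5 d1 d2 d3 d4 d5 e1 e2 e3 e4 e5 hd.
(* Multiply by L: the fifth power of L is the product of the five orders and
   of the five indices. *)
rewrite -(leq_pmul2r L0) -expnSr.
have -> : (L ^ 5 = o1 * o2 * o3 * o4 * o5 * (d1 * d2 * d3 * d4 * d5))%N.
  rewrite !expnS expn0 muln1 -{1}e1 -{1}e2 -{1}e3 -{1}e4 -{1}e5; lia.
apply: leq_trans (leq_mul (leqnn _) hd) _; apply: eq_leq; lia.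
Qed.

(** Two of the [n ^ 2] products [x ^+ i * y ^+ j] coincide.  Cancelling leaves
    a relation with nonnegative exponents, whose form depends on whether the two
    exponent differences have the same sign; keeping only differences, and not
    both pairs [(i, j)], is what later makes the number of relations quadratic. *)
Lemma small_gen2_relation (gT : finGroupType) (x y : gT) (n : nat) :
    (#|<<[set x; y]>>| < n ^ 2)%N ->
  exists u v : 'I_n, (0 < u + v)%N /\ (x ^+ u * y ^+ v = 1 \/ x ^+ u = y ^+ v).
Proof.
move=> small.
pose f (w : 'I_n * 'I_n) := x ^+ w.1 * y ^+ w.2.
have /injectivePn[w [w' ww' fE]] : ~~ injectiveb f.
  apply: contraL small => /injectiveP finj; rewrite -leqNgt.
  have -> : (n ^ 2 = #|codom f|)%N by rewrite card_codom // card_prod !card_ord.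
  apply/subset_leq_card/fintype.subsetP => _ /codomP[w ->].
  by rewrite groupM // groupX // mem_gen // !inE eqxx ?orbT.
wlog le1 : w w' ww' fE / (w'.1 <= w.1)%N.
  move=> hwlog; case: (leqP w'.1 w.1) => [|/ltnW] h; first exact: hwlog h.
  by apply: (hwlog w' w) => //; rewrite eq_sym.
have lt1 : (w.1 - w'.1 < n)%N by exact: leq_ltn_trans (leq_subr _ _) (ltn_ord _).
have ne2 : (w.1 <= w'.1 -> w.2 != w'.2 :> nat)%N.
  move=> le1'; apply: contra ww' => e2; apply/eqP.
  case: w w' le1 {fE lt1} le1' e2 => [a b] [c d] /= h1 h2 e2.
  by congr (_, _); apply: val_inj => /=; [apply/eqP; rewrite eqn_leq h2|apply/eqP].
have E : x ^+ (w.1 - w'.1) * y ^+ w.2 = y ^+ w'.2.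
  by apply: (mulgI (x ^+ w'.1)); rewrite mulgA -expgD subnKC.
exists (Ordinal lt1).
case: (leqP w'.2 w.2) => le2.
  have lt2 : (w.2 - w'.2 < n)%N by exact: leq_ltn_trans (leq_subr _ _) (ltn_ord _).
  exists (Ordinal lt2); split.
    rewrite addn_gt0 !subn_gt0 /=; case: (ltnP w'.1 w.1) => // /ne2.
    by rewrite neq_ltn ltnNge le2.
  left=> /=; apply: (mulIg (y ^+ w'.2)).
  by rewrite mul1g -mulgA -expgD subnK.
have lt2 : (w'.2 - w.2 < n)%N by exact: leq_ltn_trans (leq_subr _ _) (ltn_ord _).
exists (Ordinal lt2); split; first by rewrite addn_gt0 !subn_gt0 le2 orbT.
right=> /=; apply: (mulIg (y ^+ w.2)).
by rewrite -expgD subnK // ltnW.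
Qed.

End TwoGenerators.

(** * The integer divisible by all exceptional primes *)

Lemma size_primes_exp2 (n : nat) : (0 < n -> 2 ^ size (primes n) <= n)%N.
Proof.
move=> n0; rewrite [leqRHS](prod_prime_decomp n0) prime_decompE big_map.
rewrite -sum1_size expn_sum.
rewrite big_seq [leqRHS]big_seq; apply: leq_prod => p pn /=.
have p1 : (1 < p)%N by apply: prime_gt1; move: pn; rewrite mem_primes => /andP[].
rewrite expn1 (leq_trans p1) // -{1}(expn1 p) leq_exp2l // logn_gt0 //.
Qed.

(** [order_mod p c] is by definition the order of [red p c]. *)
Definition red (p : nat) (c : int) : {unit 'F_p} :=
  insubd (1%g : {unit 'F_p}) (c%:~R : 'F_p).

Lemma val_red (p : nat) (c : int) : prime p -> ~~ (p %| c)%Z ->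
  val (red p c) = c%:~R.
Proof.
move=> pr_p pc.
by rewrite val_insubd unitfE -(dvdz_pcharf (pchar_Fp pr_p)) (negPf pc).
Qed.

Lemma dvdz_mul_prime (p : nat) (c d : int) : prime p ->
  (p %| c * d)%Z = (p %| c)%Z || (p %| d)%Z.
Proof. by move=> pr_p; rewrite !dvdzE abszM /= Euclid_dvdM. Qed.

Lemma redM (p : nat) (c d : int) : prime p -> ~~ (p %| c)%Z -> ~~ (p %| d)%Z ->
  red p (c * d) = (red p c * red p d)%g.
Proof.
move=> pr_p pc pd; apply: val_inj.
by rewrite val_red ?dvdz_mul_prime ?negb_or ?pc // rmorphM /= !val_red.
Qed.

Lemma mult_independent_relation (a b : int) (u v : nat) :
    a != 0 -> b != 0 -> mult_independent [tuple a%:~R; b%:~R] -> (0 < u + v)%N ->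
  a ^+ u * b ^+ v != 1 /\ a ^+ u != b ^+ v.
Proof.
move=> a0 b0 hab uv.
have rel (z : int) : (a%:~R : rat) ^ (u : int) * b%:~R ^ z = 1 -> u = 0%N /\ z = 0.
  move=> e; pose e2 (i : 'I_2) : int := if i == 0 then (u : int) else z.
  have h : \prod_(i < 2) tnth [tuple a%:~R; b%:~R] i ^ e2 i = 1 :> rat.
    by rewrite !big_ord_recl big_ord0 mulr1.
  by split; [have [] := hab e2 h 0 | exact: hab e2 h 1].
split; apply/eqP => e.
  have := rel v; rewrite -!exprnP -!rmorphXn -rmorphM /= e => /(_ erefl)[u0 [v0]].
  by rewrite u0 v0 in uv.
have := rel (- (v : int)); rewrite -exprnN -exprnP -!rmorphXn /= e.
rewrite divff ?intr_eq0 ?expf_neq0 // => /(_ erefl)[u0 /eqP].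
by rewrite oppr_eq0 => /eqP[v0]; rewrite u0 v0 in uv.
Qed.

(** The factor [a * b] accounts for the primes modulo which [a] or [b] is not
    a unit. *)
Definition relation_product (a b : int) (n : nat) : nat :=
  (`|(a * b)%R| * \prod_(w : 'I_n * 'I_n | 0 < w.1 + w.2)
     (`|(a ^+ w.1 * b ^+ w.2 - 1)%R| * `|(a ^+ w.1 - b ^+ w.2)%R|))%N.

Lemma relation_product_gt0 (a b : int) (n : nat) :
    a != 0 -> b != 0 -> mult_independent [tuple a%:~R; b%:~R] ->
  (0 < relation_product a b n)%N.
Proof.
move=> a0 b0 hab; rewrite muln_gt0 absz_gt0 mulf_neq0 // prodn_cond_gt0 // => w w0.
have [e1 e2] := mult_independent_relation a0 b0 hab w0.
by rewrite muln_gt0 !absz_gt0 !subr_eq0 e1.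
Qed.

(** There are at most [n ^ 2] index pairs, each contributing at most
    [M ^ (4 * n)] with [M = `|a| + `|b|], and [M <= 2 ^ M]. *)
Lemma relation_product_le (a b : int) (n : nat) : a != 0 -> b != 0 -> (0 < n)%N ->
  (relation_product a b n <= 2 ^ (6 * (`|a| + `|b|) * n ^ 3))%N.
Proof.
move=> a0 b0 n0; set M := (`|a| + `|b|)%N.
have aM : (`|a| <= M)%N by rewrite leq_addr.
have bM : (`|b| <= M)%N by rewrite leq_addl.
have M2 : (1 < M)%N by rewrite -!absz_gt0 in a0 b0; rewrite /M; lia.
have M0 : (0 < M)%N by exact: ltnW.
have expM i j : (i <= j -> M ^ i <= M ^ j)%N by rewrite leq_exp2l.
have double s t e : (s <= M ^ e -> t <= M ^ e -> e < 2 * n -> s + t <= M ^ (2 * n))%N.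
  move=> hs ht he; apply: leq_trans (expM _ _ he).
  rewrite expnS (leq_trans (leq_add hs ht)) // addnn -mul2n leq_mul2r M2 orbT //.
have factor (w : 'I_n * 'I_n) :
    (`|(a ^+ w.1 * b ^+ w.2 - 1)%R| * `|(a ^+ w.1 - b ^+ w.2)%R| <= M ^ (4 * n))%N.
  have -> : (4 * n = 2 * n + 2 * n)%N by lia.
  have dist (c d : int) : (`|(c - d)%R| <= `|c| + `|d|)%N.
    by have := leqD_dist c 0 d; rewrite subr0 sub0r abszN.
  have pow (c : int) (i : 'I_n) : (`|c| <= M -> `|(c ^+ i)%R| <= M ^ n.-1)%N.
    move=> cM; have le_i : (i <= n.-1)%N by rewrite -ltnS prednK.
    rewrite abszX; apply: leq_trans (expM _ _ le_i).
    by case: (posnP i) => [->|i0]; rewrite ?expn0 // leq_exp2r.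
  rewrite expnD; apply: leq_mul; apply: leq_trans (dist _ _) _.
    apply: (@double _ _ (n.-1 + n.-1)%N); last by lia.
      by rewrite abszM expnD leq_mul ?pow.
    by rewrite expn_gt0 M0.
  by apply: (@double _ _ n.-1); rewrite ?pow //; lia.
have prodM : (relation_product a b n <= M ^ (6 * n ^ 3))%N.
  have -> : (6 * n ^ 3 = 2 * n ^ 3 + 4 * n * (n * n))%N by lia.
  rewrite expnD; apply: leq_mul.
    have /expM : (2 <= 2 * n ^ 3)%N by rewrite leq_pmulr ?expn_gt0 ?n0.
    by apply: leq_trans; rewrite abszM -mulnn leq_mul.
  have -> : (n * n = #|{: 'I_n * 'I_n}|)%N by rewrite card_prod card_ord.
  rewrite expnM -prod_nat_const big_mkcond.
  apply: leq_prod => w _; case: ifP => _ //; last by rewrite expn_gt0 M0.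
apply: leq_trans prodM _; have -> : (6 * M * n ^ 3 = M * (6 * n ^ 3))%N by lia.
rewrite [leqRHS]expnM; case: (posnP (6 * n ^ 3)) => [->|h] //.
by rewrite leq_exp2r // ltnW // ltn_expl.
Qed.

(** A small subgroup forces a short relation modulo [p], and [p] then divides
    the factor of [relation_product] attached to the exponents of that relation. *)
Lemma card_red_ge (a b : int) (n p : nat) : prime p ->
    ~~ (p %| relation_product a b n)%N ->
  (n ^ 2 <= #|<<[set red p a; red p b]%SET>>%g|)%N.
Proof.
move=> pr_p; apply: contraR; rewrite -ltnNge => small.
have [|pab] := boolP (p %| a * b)%Z; first by rewrite dvdzE => h; rewrite dvdn_mulr.
move: pab; rewrite (dvdz_mul_prime _ _ pr_p) negb_or => /andP[pa pb].
have [u [v [uv rel]]] := small_gen2_relation small.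
rewrite dvdn_mull // (bigD1 (u, v)) //= dvdn_mulr //.
have toF (c d : int) : c%:~R = d%:~R :> 'F_p -> (p %| absz (c - d))%N.
  move=> cd; rewrite -[(_ %| _)%N]/(p %| c - d)%Z (dvdz_pcharf (pchar_Fp pr_p)).
  by rewrite rmorphB /= cd subrr.
case: rel => /(congr1 val); rewrite ?FinRing.val_unitM !FinRing.val_unitX !val_red // => e.
  by rewrite dvdn_mulr // toF // rmorphM !rmorphXn.
by rewrite dvdn_mull // toF // !rmorphXn.
Qed.

(** * Counting exceptions *)

Lemma leq_num_exceptions (R : realType) (P : nat -> Prop) (x : R) (n : nat) :
    (0 < n)%N -> (forall p, prime p -> p%:R <= x -> ~ P p -> (p %| n)%N) -> 0 <= x ->
  (num_exceptions P x <= size (primes n))%N.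
Proof.
move=> n0 hP x0; rewrite /num_exceptions -big_filter sum1_size.
apply: uniq_leq_size; first by rewrite filter_uniq ?iota_uniq.
move=> p; rewrite mem_filter mem_index_iota mem_primes n0 /= ltnS.
move=> /andP[/andP[pr_p /asboolPn nP] px]; rewrite pr_p hP //.
by apply: le_trans (_ : (Num.truncn x)%:R <= x); rewrite ?ler_nat // truncn_le.
Qed.

(** With [s = sqrt (ln p)], the logarithm of the threshold is the quadratic
    [8 / 15 * s ^+ 2 - 2 * s].  It is not monotone, but it is convex and vanishes
    at [0] and [15 / 4], so it is maximal at [S] among [0 <= s <= S] once
    [15 / 4 <= S]. *)
Lemma threshold_le (R : realType) (p x : R) : 1 <= p -> p <= x ->
    15 / 4 <= Num.sqrt (ln x) ->
  p `^ (8 / 15) / expR (2 * Num.sqrt (ln p)) <=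
  expR (8 / 15 * Num.sqrt (ln x) ^+ 2 - 2 * Num.sqrt (ln x)).
Proof.
move=> p1 px hS.
have p0 : 0 < p by exact: lt_le_trans p1.
have x0 : 0 < x by exact: lt_le_trans px.
rewrite /powR gt_eqF // -expRN -expRD ler_expR.
have := ln_ge0 p1 => lp0.
rewrite -{1}(sqr_sqrtr lp0).
have := sqrtr_ge0 (ln p).
have : Num.sqrt (ln p) <= Num.sqrt (ln x) by rewrite ler_wsqrtr // ler_ln.
move: hS; move: (Num.sqrt _) (Num.sqrt _) => S s hS sS s0.
nra.
Qed.

(** The eighth power of [2 * expR (S ^+ 2 / 3 - 5 / 4 * S)] is [256 * F ^+ 5],
    which exceeds the bound [12 * F ^+ 5] for the fourth power of [L]. *)
Lemma card_lt_of_orders (R : realType) (S : R) (L o1 o2 o3 o4 o5 : nat)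
    (F := expR (8 / 15 * S ^+ 2 - 2 * S)) :
    (L ^ 4 <= 12 * (o1 * o2 * o3 * o4 * o5))%N ->
    o1%:R <= F -> o2%:R <= F -> o3%:R <= F -> o4%:R <= F -> o5%:R <= F ->
  L%:R < (2 * expR (S ^+ 2 / 3 - 5 / 4 * S)) ^+ 2.
Proof.
move=> hL h1 h2 h3 h4 h5; set T := 2 * _.
have T0 : 0 < T by rewrite mulr_gt0 ?expR_gt0.
have F0 : 0 < F := expR_gt0 _.
have hF : L%:R ^+ 4 <= 12 * F ^+ 5.
  rewrite -natrX (le_trans (_ : _ <= (12 * (o1 * o2 * o3 * o4 * o5))%:R)) ?ler_nat //.
  by rewrite !natrM ler_wpM2l // !exprS expr0 mulr1 !mulrA !ler_pM // !mulr_ge0.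
have TF : T ^+ 2 ^+ 4 = 256 * F ^+ 5.
  rewrite -exprM /T exprMn -!expRM_natl; congr (_ * expR _); last by field.
  by rewrite -natrX.
rewrite -(ltr_pXn2r (n := 4)) ?nnegrE ?sqr_ge0 ?ler0n // TF.
apply: le_lt_trans hF _; rewrite ltr_pM2r ?exprn_gt0 // ltr_nat //.
Qed.

(** The left-hand side is [64 * M * S ^+ 2 / expR (15 / 4 * S)], and
    [expR (15 / 4 * S) >= expR S >= S ^+ 3 / 6]. *)
Lemma bound_ratio_le (R : realType) (S M : R) : 15 / 4 <= S -> 0 <= M ->
  M * (2 * (2 * expR (S ^+ 2 / 3 - 5 / 4 * S))) ^+ 3 / (expR (S ^+ 2) / S ^+ 2)
  <= 384 * M / S.
Proof.
move=> hS M0.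
have S0 : 0 < S by lra.
rewrite mulrA exprMn -expRM_natl.
have -> : 3%:R * (S ^+ 2 / 3 - 5 / 4 * S) = S ^+ 2 - 15 / 4 * S :> R by field.
rewrite expRD expRN.
have hexp : S ^+ 3 / 6 <= expR (15 / 4 * S).
  have := @expR_ge1Dxn R S 2 (ltW S0); rewrite -[3`!]/6%N => h.
  have : expR S <= expR (15 / 4 * S) by rewrite ler_expR; lra.
  lra.
set E := expR (15 / 4 * S) in hexp *.
have E0 : 0 < E := expR_gt0 _.
set X := expR (S ^+ 2); have X0 : 0 < X := expR_gt0 _.
have -> : M * ((2 * 2) ^+ 3 * (X / E)) / (X / S ^+ 2) = 64 * M / S * (S ^+ 3 / E).
  by field; rewrite !gt_eqF.
have -> : 384 * M / S = 64 * M / S * 6 by field; rewrite gt_eqF.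
apply: ler_wpM2l; last by rewrite ler_pdivrMr //; lra.
by rewrite divr_ge0 ?mulr_ge0 // ltW.
Qed.

Unset Implicit Arguments.
Set Strict Implicit.

(** * Conclusion *)

Theorem theorem1p1 (R : realType) (a b : int)
    (ha : a != 0) (hb : b != 0)
    (hab : mult_independent [tuple a%:~R; b%:~R]) :
  almost_all_primes R (fun p : nat =>
    exists c : int,
      [/\ c \in [:: a; b; a * b; a ^+ 2 * b; a * b ^+ 2],
          ~~ (p %| c)%Z
        & (p%:R : R) `^ (8 / 15) / expR (2 * Num.sqrt (ln p%:R))
            < (order_mod p c)%:R]).
Proof.
set P := (fun p : nat => _).
pose M : R := 6 * (`|a| + `|b|)%N%:R.
have M0 : 0 <= M by rewrite mulr_ge0.
have key (x : R) : 1 < x -> 15 / 4 <= Num.sqrt (ln x) ->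
    (num_exceptions P x)%:R / (x / ln x) <= 384 * M / Num.sqrt (ln x).
  move=> x1 hS; set S := Num.sqrt (ln x) in hS *.
  have x0 : 0 < x by exact: lt_trans x1.
  have lnE : ln x = S ^+ 2 by rewrite sqr_sqrtr // ln_ge0 // ltW.
  have xE : x = expR (S ^+ 2) by rewrite -lnE lnK.
  pose T : R := 2 * expR (S ^+ 2 / 3 - 5 / 4 * S).
  pose n := (Num.truncn T).+1.
  have T0 : 0 < T by rewrite mulr_gt0 ?expR_gt0.
  have T1 : 1 <= T.
    have : 0 <= S * (S - 15 / 4) by apply: mulr_ge0; lra.
    have -> : S * (S - 15 / 4) = 3 * (S ^+ 2 / 3 - 5 / 4 * S) by field.
    rewrite pmulr_rge0 // -ler_expR expR0 => E1.
    rewrite /T; lra.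
  have Tn : T < n%:R by rewrite truncnS_gt.
  have nT : n%:R <= 2 * T.
    have : (Num.truncn T)%:R <= T by rewrite truncn_le; exact: ltW.
    by rewrite /n -natr1; lra.
  have exc p : prime p -> p%:R <= x -> ~ P p -> (p %| relation_product a b n)%N.
    move=> pr_p px nP; apply: contra_notT nP => ndiv.
    have [pa pb] : ~~ (p %| a)%Z /\ ~~ (p %| b)%Z.
      apply/andP; rewrite -negb_or -dvdz_mul_prime //; apply: contra ndiv.
      by rewrite dvdzE => h; rewrite dvdn_mulr.
    have cardG := card_red_ge pr_p ndiv.
    have p1 : 1 <= p%:R :> R by rewrite ler1n prime_gt0.
    have thr := threshold_le p1 px hS.
    apply: contrapT => /forallNP small.
    have ord c : c \in [:: a; b; a * b; a ^+ 2 * b; a * b ^+ 2] ->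
        ~~ (p %| c)%Z -> #[red p c]%g%:R <= expR (8 / 15 * S ^+ 2 - 2 * S).
      move=> cin pc; apply: le_trans thr; rewrite leNgt; apply/negP => lt_c.
      by apply: (small c); split.
    have pM c d : ~~ (p %| c)%Z -> ~~ (p %| d)%Z -> ~~ (p %| c * d)%Z.
      by move=> pc pd; rewrite dvdz_mul_prime // negb_or pc.
    have [paa pbb] : ~~ (p %| a ^+ 2)%Z /\ ~~ (p %| b ^+ 2)%Z by rewrite !pM.
    have := card_gen2_le_orders (field_unit_group_cyclic [set: {unit 'F_p}]%G)
      (finset.in_setT (red p a)) (finset.in_setT (red p b)).
    have -> : (red p a ^+ 2 * red p b = red p (a ^+ 2 * b))%g.
      by rewrite !redM // expgS expg1.
    have -> : (red p a * red p b ^+ 2 = red p (a * b ^+ 2))%g.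
      by rewrite !redM // expgS expg1.
    rewrite -redM // => h.
    have ltT : #|<<[set red p a; red p b]%SET>>%g|%:R < T ^+ 2.
      by apply: (card_lt_of_orders h); apply: ord; rewrite ?pM ?inE ?eqxx ?orbT.
    have : (n ^ 2)%:R < n%:R ^+ 2 :> R.
      apply: le_lt_trans (_ : _ <= #|<<[set red p a; red p b]%SET>>%g|%:R) _.
        by rewrite ler_nat.
      by apply: lt_trans ltT _; rewrite ltrXn2r // ltW.
    by rewrite natrX ltxx.
  have cnt : (num_exceptions P x <= 6 * (`|a| + `|b|) * n ^ 3)%N.
    have Q0 := relation_product_gt0 n ha hb hab.
    apply: leq_trans (leq_num_exceptions Q0 exc (ltW x0)) _.
    rewrite -(leq_exp2l _ _ (isT : 1 < 2)%N) (leq_trans (size_primes_exp2 Q0)) //.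
    exact: relation_product_le.
  apply: le_trans (bound_ratio_le hS M0); rewrite lnE -xE ler_pM2r; last first.
    by rewrite invr_gt0 divr_gt0 // exprn_gt0 //; lra.
  have cntR : (num_exceptions P x)%:R <= M * n%:R ^+ 3.
    by rewrite /M -natrX -!natrM ler_nat.
  apply: le_trans cntR _; apply: ler_wpM2l => //.
  by rewrite lerXn2r // nnegrE ?mulr_ge0 // ltW.
(* The lower bound on x below makes S exceed both 15 / 4 and 384 * M / e. *)
apply/cvgrPdist_lt => e e0; near=> x.
have hx : expR ((15 / 4 + 384 * M / e) ^+ 2) < x.
  by near: x; apply: nbhs_pinfty_gt; rewrite num_real.
have K0 : 0 <= 384 * M / e by rewrite divr_ge0 ?mulr_ge0 // ltW.
have x1 : 1 < x by apply: le_lt_trans hx; rewrite -expR0 ler_expR sqr_ge0.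
have hS : 15 / 4 + 384 * M / e < Num.sqrt (ln x).
  have K1 : 0 <= 15 / 4 + 384 * M / e by lra.
  rewrite -(ger0_norm K1) -sqrtr_sqr ltr_sqrt ?ln_gt0 //.
  by rewrite -[ltLHS]expRK ltr_ln // ?posrE ?expR_gt0 // (lt_trans ltr01).
rewrite sub0r normrN ger0_norm; last first.
  by rewrite !divr_ge0 ?ln_ge0 // ltW // (lt_trans ltr01).
have S0 : 0 < Num.sqrt (ln x) by lra.
apply: le_lt_trans (key x x1 _) _; first lra.
rewrite ltr_pdivrMr // (mulrC e) -ltr_pdivrMr //; lra.
Unshelve. all: by end_near.
Qed.
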